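(* Let $m\ge1$. If $z=1$, then $\mathrm{TD}(\mathrm{QR}^1_{\infty,m})=3$. If $z\ge2$, then for every $\pi\in\mathrm{QR}^z_{\infty,m}$, $\mathrm{TD}(\pi,\mathrm{QR}^z_{\infty,m})=O\big(2^{|\pi(\varepsilon)|}+D\cdot(|\pi(\varepsilon)|+D\cdot m)^{D\cdot m}\big)$, where $D:=\max\{\tfrac1m(2|\pi|-|\pi(\varepsilon)|),\;1+(|\pi(\varepsilon)|+m+4)\cdot|\mathrm{Var}(\pi)|\}$; in particular it is finite.
   Context: Fix a countably infinite set $X$ of variables and an alphabet $\Sigma$ (finite or countably infinite, disjoint from $X$), $z=|\Sigma|$. A pattern is a nonempty finite string over $X\cup\Sigma$; $\mathrm{Var}(\pi)$ is its set of variables, $|\pi|$ its length, $\pi(\varepsilon)$ the word obtained by deleting all variables. A substitution is a morphism $h:(X\cup\Sigma)^*\to\Sigma^*$ fixing letters; $L(\pi)$ (erasing pattern language) is the set of all $h(\pi)$. A pattern is $m$-quasi-regular if every variable occurring in it occurs exactly $m$ times; $\mathrm{QR}^z_{\infty,m}$ is the class of all $m$-quasi-regular patterns over an alphabet of size $z$. A labelled example is $(w,\pm)$ with $w\in\Sigma^*$; a teaching set for $\pi$ w.r.t. a class $\Pi$ is a set $T$ of labelled examples consistent with $\pi$ ($w\in L(\pi)$ iff the label is $+$) such that every $\tau\in\Pi$ consistent with $T$ has $L(\tau)=L(\pi)$; $\mathrm{TD}(\pi,\Pi)$ is its minimum size ($\infty$ if none finite), and $\mathrm{TD}(\Pi)=\sup_{\pi\in\Pi}\mathrm{TD}(\pi,\Pi)$.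 *)

(* Defs.v *)
From mathcomp Require Import all_boot all_order all_algebra.
Set Implicit Arguments. Unset Strict Implicit. Unset Printing Implicit Defensive.

(* Variables are X := nat (countably infinite); letters come from an alphabet
   A : countType (finite or countably infinite); z = |A|. *)
Definition symbol (A : Type) := (nat + A)%type.
Definition word (A : Type) := seq A.
Definition pattern (A : Type) := seq (symbol A).

Definition is_pattern (A : Type) (p : pattern A) : Prop := p <> [::].

(* substitution: morphism fixing letters, variables mapped to arbitrary words
   (erasing: the empty word is allowed) *)
Definition subst_sym (A : Type) (h : nat -> word A) (s : symbol A) : word A :=
  match s with inl x => h x | inr a => [:: a] end.
Definition subst (A : Type) (h : nat -> word A) (p : pattern A) : word A :=
  flatten (map (subst_sym h) p).

Definition inL (A : Type) (p : pattern A) (w : word A) : Prop :=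
  exists h : nat -> word A, subst h p = w.

Definition is_var (A : Type) (s : symbol A) : bool :=
  if s is inl _ then true else false.
Definition is_letter (A : Type) (s : symbol A) : bool :=
  if s is inr _ then true else false.

Definition occ (A : eqType) (x : nat) (p : pattern A) : nat :=
  count (fun s => s == inl x) p.

Definition vars (A : Type) (p : pattern A) : seq nat :=
  undup (pmap (fun s => if s is inl x then Some x else None) p).

(* |p(ε)| : length of the word obtained by deleting all variables *)
Definition const_len (A : Type) (p : pattern A) : nat := count (@is_letter A) p.

Definition QR (A : eqType) (m : nat) (p : pattern A) : Prop :=
  is_pattern p /\ forall x : nat, 0 < occ x p -> occ x p = m.

Definition consistent (A : eqType) (p : pattern A) (T : seq (word A * bool)) : Prop :=
  forall w b, (w, b) \in T -> (inL p w <-> b = true).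

Definition same_lang (A : Type) (p q : pattern A) : Prop :=
  forall w, inL p w <-> inL q w.

Definition teaching_set (A : eqType) (Pi : pattern A -> Prop) (p : pattern A)
    (T : seq (word A * bool)) : Prop :=
  consistent p T /\ forall q, Pi q -> consistent q T -> same_lang q p.

Definition TDle (A : eqType) (Pi : pattern A -> Prop) (p : pattern A) (n : nat) : Prop :=
  exists T, teaching_set Pi p T /\ size T <= n.

(* is_TD Pi p k : TD(p, Pi) = k, where None stands for ∞. *)
Definition is_TD (A : eqType) (Pi : pattern A -> Prop) (p : pattern A)
    (k : option nat) : Prop :=
  match k with
  | Some n => TDle Pi p n /\ forall n', TDle Pi p n' -> n <= n'
  | None => forall n, ~ TDle Pi p n
  end.

Definition TD_at_most (A : eqType) (Pi : pattern A -> Prop) (p : pattern A) (n : nat) : Prop :=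
  exists k, is_TD Pi p (Some k) /\ k <= n.

(* is_TD_class Pi k : TD(Pi) = sup_{p in Pi} TD(p, Pi) = k, None = ∞. *)
Definition is_TD_class (A : eqType) (Pi : pattern A -> Prop) (k : option nat) : Prop :=
  match k with
  | Some n => (forall p, Pi p -> TD_at_most Pi p n) /\
              (forall n', (forall p, Pi p -> TD_at_most Pi p n') -> n <= n')
  | None => forall n, ~ (forall p, Pi p -> TD_at_most Pi p n)
  end.

(* D * m = max{2|p| - |p(ε)|, m * (1 + (|p(ε)| + m + 4) * |Var(p)|)} *)
Definition Dm (A : Type) (m : nat) (p : pattern A) : nat :=
  maxn (2 * size p - const_len p) (m * (1 + (const_len p + m + 4) * size (vars p))).

Definition TD_bound (A : Type) (m : nat) (p : pattern A) : rat :=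
  let e := const_len p in
  let dm := Dm m p in
  ((2 ^ e)%N%:R + (dm%:R / m%:R) * ((e + dm)%N%:R) ^+ dm)%R.

(* Main.v *)
(** A pattern consistent with the subsequences of the constant word of [p] has
the same constant word as [p]; it remains to bound the number of variables that
matter.  Call a variable [y] of [t] linked to [y'] if [y'] follows [y]
immediately at each of its [m] occurrences; then [y'] can be erased without
changing the language of [t].  If [L(t)] is included in [L(p)], at most
[|p(eps)| + |Var(p)|] variables of [t] are unlinked: substitute for every variable
of [t] many distinct markers [a b^N a] and compare with the resulting
substitution of [p].  Erasing a variable creates at most [m] new links, hence a
pattern [t] with [L(t)] not included in [L(p)] that is minimal for erasing
variables has at most [1 + m + |p(eps)| + |Var(p)|] variables.  So it suffices to
separate [p] from the patterns with few variables, negatively whenever this is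
possible so that the example also excludes every larger language. *)

Require Import Defs.
From Stdlib Require Import Classical.
From mathcomp Require Import all_boot all_order all_algebra.
From mathcomp Require Import zify.
Import Order.TTheory GRing.Theory Num.Theory.
Set Implicit Arguments. Unset Strict Implicit. Unset Printing Implicit Defensive.

(** * Counting adjacent pairs in a sequence *)

Fixpoint adj (T : eqType) (t t' : T) (s : seq T) : nat :=
  if s is c :: s1 then ((c == t) && (ohead s1 == Some t')) + adj t t' s1 else 0.

Section Adjacency.
Variable T : eqType.
Implicit Types (t c : T) (s : seq T).

Lemma adj_cat_ge t t' s1 s2 : adj t t' s1 + adj t t' s2 <= adj t t' (s1 ++ s2).
Proof.
elim: s1 => //= c s1 IH; rewrite -addnA leq_add //.
by case: s1 {IH} => [|d s1] //=; rewrite andbF.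
Qed.

Lemma adj_cat_cons t t' c s1 s2 :
  adj t t' ((c :: s1) ++ s2) =
  adj t t' (c :: s1) + ((last c s1 == t) && (ohead s2 == Some t')) + adj t t' s2.
Proof.
elim: s1 c => [|d s1 IH] c; first by rewrite /= andbF.
by have /= -> := IH d; rewrite !addnA.
Qed.

Lemma adj_le_count t t' s : adj t t' s <= count_mem t s.
Proof. by elim: s => //= c s IH; rewrite leq_add //; case: (c == t) => //=; case: eqP. Qed.

Lemma adj_le_count_behead t t' s : adj t t' s <= count_mem t' (behead s).
Proof.
elim: s => //= c [|d s] IH; first by rewrite /= andbF.
rewrite /= in IH *; rewrite leq_add //.
by case: (c == t) => //=; rewrite (inj_eq Some_inj).
Qed.

Lemma adj_map (T' : eqType) (f : T -> T') t t' s :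
  injective f -> adj (f t) (f t') (map f s) = adj t t' s.
Proof.
move=> fI; elim: s => //= c [|d s] IH; first by rewrite /= !andbF.
by rewrite /= in IH *; rewrite IH !(inj_eq Some_inj) !(inj_eq fI).
Qed.

Lemma adj_iota (t t' : nat) n k :
  0 < adj t t' (iota n k) -> [/\ t' = t.+1, n <= t & t.+1 < n + k].
Proof.
elim: k n => //= k IH n; rewrite addn_gt0 => /orP[|/IH[-> ? ?]]; last by split; lia.
case: eqP => //= <-; case: k {IH} => //= k; case: eqP => // -[<-] _.
by split; lia.
Qed.

(* Deleting an element creates at most one new adjacent pair, whose first
   component is the predecessor of the deleted element. *)
Lemma adj_filter (P : pred T) s :
  exists2 Q : seq T, size Q <= count P s &
    forall t t', t \notin Q -> adj t t' (filter (predC P) s) <= adj t t' s.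
Proof.
(* The head has no predecessor, so its deletion creates no pair. Counting over [behead s] lets the
   induction charge [c] for the deletion of [d]. *)
suff [Q Qs Qle] : exists2 Q : seq T, size Q <= count P (behead s) &
    forall t t', t \notin Q -> adj t t' (filter (predC P) s) <= adj t t' s.
  by exists Q => //; apply: leq_trans Qs _; case: s {Qle} => //= c s; lia.
elim: s => [|c [|d s] IH]; first by exists [::].
  by exists [::] => //= t t' _; case: (P c) => //=; rewrite andbF.
have [Q Qs Qle] := IH; rewrite /= in Qs.
case Pd: (P d).
  exists (c :: Q) => [|t t']; first by rewrite /= Pd.
  rewrite inE negb_or eq_sym => /andP[tc tQ]; have := Qle t t' tQ.
  by rewrite /= Pd /=; case: (P c) => /=; rewrite (negbTE tc).
exists Q => [|t t' tQ]; first by rewrite /= Pd.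
have := Qle t t' tQ; rewrite /= Pd /=; case: (P c) => /= H; last by rewrite leq_add2l.
by apply: leq_trans H _; rewrite leq_addl.
Qed.

End Adjacency.

(** * Patterns, erasing of variables, and linked variables *)

Local Arguments occ : simpl never.
Local Notation vadj x y p := (adj (@inl nat _ x) (@inl nat _ y) p).

Definition var_seq (A : Type) (p : pattern A) : seq nat :=
  pmap (fun s => if s is inl x then Some x else None) p.
Definition consts (A : Type) (p : pattern A) : word A :=
  pmap (fun s => if s is inr c then Some c else None) p.
Definition erase (A : eqType) (y : nat) (p : pattern A) : pattern A :=
  filter (predC (pred1 (inl y))) p.
(** This is [QR] without nonemptiness, because erasing variables may lead to the empty pattern. *)
Definition multiplicity (A : eqType) (m : nat) (p : pattern A) : Prop :=
  forall x : nat, 0 < occ x p -> occ x p = m.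
Definition sublang (A : Type) (p q : pattern A) : Prop :=
  forall w, inL p w -> inL q w.

Section Patterns.
Variable A : eqType.
Implicit Types (p q : pattern A) (w u v : word A) (h g : nat -> word A).

Lemma occE x p : occ x p = count_mem x (var_seq p).
Proof. by elim: p => //= -[y|c] p; rewrite /occ /= => ->. Qed.

Lemma const_lenE p : const_len p = size (consts p).
Proof. by elim: p => //= -[y|c] p; rewrite /const_len /= => ->. Qed.

Lemma mem_vars x p : (x \in vars p) = (0 < occ x p).
Proof. by rewrite mem_undup occE -has_count has_pred1. Qed.

Lemma mem_var_seq x p : (x \in var_seq p) = (inl x \in p).
Proof. by elim: p => //= -[y|c] p IH; rewrite !inE IH. Qed.

Lemma mem_vars_inl x p : (x \in vars p) = (inl x \in p).
Proof. by rewrite mem_undup mem_var_seq. Qed.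

Lemma vars_uniq p : uniq (vars p). Proof. exact: undup_uniq. Qed.

Lemma var_seqE p : map inl (var_seq p) = filter (predC (@is_letter A)) p :> pattern A.
Proof. by elim: p => //= -[y|c] p /= ->. Qed.

Lemma size_pattern p : size p = const_len p + size (var_seq p).
Proof. by elim: p => //= -[y|c] p; rewrite /const_len /= => ->; lia. Qed.

Lemma subst_nil p : subst (fun=> [::]) p = consts p.
Proof. by elim: p => //= -[y|c] p; rewrite /subst /= => ->. Qed.

Lemma inL_consts p : inL p (consts p).
Proof. by exists (fun=> [::]); rewrite subst_nil. Qed.

Lemma inL_subseq p w : inL p w -> subseq (consts p) w.
Proof.
case=> h <-; elim: p => //= -[y|c] p IH; rewrite /subst /=.
  by rewrite -(cat0s (consts p)) cat_subseq // sub0seq.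
by rewrite eqxx.
Qed.

Lemma eq_in_subst h g p : {in vars p, h =1 g} -> subst h p = subst g p.
Proof.
move=> hg; rewrite /subst; congr flatten; apply/eq_in_map => -[x|c] //= xp.
by apply: hg; rewrite mem_vars_inl.
Qed.

Lemma subst_no_vars h p : vars p = [::] -> subst h p = consts p.
Proof. by move=> p0; rewrite -subst_nil; apply: eq_in_subst => x; rewrite p0. Qed.

Lemma size_subst h p :
  size (subst h p) = const_len p + sumn [seq size (h x) | x <- var_seq p].
Proof.
elim: p => //= -[x|c] p; rewrite /subst /const_len /= => IH; last by rewrite IH.
by rewrite size_cat IH; lia.
Qed.

Lemma var_seq_perm m p : multiplicity m p ->
  perm_eq (var_seq p) (flatten [seq nseq m x | x <- vars p]).
Proof.
move=> pm; apply/allP => x _ /=; apply/eqP.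
rewrite count_flatten -map_comp.
rewrite (_ : [seq _ | _ <- _] = [seq m * (y == x) | y <- vars p]); last first.
  by apply: eq_map => y /=; rewrite count_nseq mulnC.
rewrite -occE.
have -> : sumn [seq m * (y == x) | y <- vars p] = m * count_mem x (vars p).
  by elim: (vars p) => [|y l /= ->]; rewrite ?muln0 ?mulnDr.
rewrite count_uniq_mem ?vars_uniq // mem_vars.
by case: posnP => [->|/pm ->]; rewrite ?muln0 ?muln1.
Qed.

Lemma size_subst_mult m h p : multiplicity m p ->
  size (subst h p) = const_len p + m * sumn [seq size (h x) | x <- vars p].
Proof.
move=> pm; rewrite size_subst; congr (_ + _).
rewrite (perm_sumn (perm_map _ (var_seq_perm pm))).
elim: (vars p) => [|x l IH]; first by rewrite muln0.
rewrite /= map_cat sumn_cat IH map_nseq sumn_nseq; lia.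
Qed.

Lemma occ_erase x y p : occ x (erase y p) = if x == y then 0 else occ x p.
Proof.
rewrite /occ /erase count_filter; case: eqP => [->|/eqP xy].
  by rewrite (eq_count (a2 := pred0)) ?count_pred0 // => s /=; case: eqP.
apply: eq_count => s /=; case: eqP => //= ->.
by apply: contra xy => /eqP[->].
Qed.

Lemma multiplicity_erase m y p : multiplicity m p -> multiplicity m (erase y p).
Proof. by move=> pm x; rewrite occ_erase; case: eqP => // _ /pm. Qed.

Lemma consts_erase y p : consts (erase y p) = consts p.
Proof. by elim: p => //= -[x|c] p /=; [case: eqP|move=> ->]. Qed.

Lemma subst_erase h y p :
  subst h (erase y p) = subst (fun x => if x == y then [::] else h x) p.
Proof.
elim: p => //= -[x|c] p; rewrite /subst /= => IH; last by rewrite IH.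
rewrite (inj_eq (fun a b => @inl_inj _ _ a b)).
by case: eqP => [->|] /=; rewrite ?eqxx IH.
Qed.

Lemma sublang_erase y p : sublang (erase y p) p.
Proof. by move=> w [h <-]; rewrite subst_erase; eexists. Qed.

Lemma size_erase m y p : multiplicity m p -> y \in vars p ->
  size (erase y p) + m = size p.
Proof.
rewrite mem_vars => pm /pm <-; rewrite size_filter /occ addnC.
exact: (count_predC (fun s => s == inl y)).
Qed.

Lemma inl_eq (x y : nat) : ((inl x : symbol A) == inl y) = (x == y).
Proof. by apply/eqP/eqP => [[]|->]. Qed.

Lemma occ_cons x s p : occ x (s :: p) = (s == inl x) + occ x p.
Proof. by []. Qed.

Lemma adj_le_occ x y p : vadj x y p <= occ x p.
Proof. exact: adj_le_count. Qed.

Lemma adj_le_occ_behead x y p : vadj x y p <= occ y (behead p).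
Proof. exact: adj_le_count_behead. Qed.

Lemma occ_behead x p : occ x (behead p) <= occ x p.
Proof. by case: p => //= s p; rewrite occ_cons leq_addl. Qed.

(* If every [y] is followed by [y'] and every [y'] preceded by [y], then
   [y] can take over the image of [y']. *)
Lemma subst_linked h y y' p : y != y' ->
    occ y p <= vadj y y' p -> occ y' p <= vadj y y' p ->
  subst (fun x => if x == y then h y ++ h y' else h x) (erase y' p) = subst h p.
Proof.
move=> yy'; have [n] := ubnP (size p); elim: n p => // n IH [|c p] //= pn.
rewrite !occ_cons.
have [cy|cy] := eqVneq c (inl y); last first.
  rewrite /= !add0n => oy oy'; have [cy'|cy'] := eqVneq c (inl y').
    (* A leading [y'] has no predecessor, so there would be fewer pairs than occurrences of [y']. *)
    have := adj_le_occ_behead y y' p; have := occ_behead y' p.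
    by move: oy'; rewrite cy' eqxx /=; lia.
  rewrite (negbTE cy') /= add0n in oy'.
  rewrite /subst /= -!/(subst _ _) IH //.
  by case: c cy {cy'} => //= x; rewrite inl_eq => /negbTE ->.
rewrite {}cy inl_eq (negbTE yy') /= add0n.
have Sp := adj_le_occ y y' p.
case: p pn Sp => [|d p] //= pn Sp; rewrite (inj_eq Some_inj).
(* If the leading [y] were not followed by [y'], there would be fewer pairs than occurrences of
   [y]. *)
have [dy'|dy'] := eqVneq d (inl y'); last by rewrite /=; lia.
rewrite {}dy' inl_eq [y' == y]eq_sym (negbTE yy') /= !occ_cons !inl_eq eqxx.
rewrite [y' == y]eq_sym (negbTE yy') /= => oy oy'.
by rewrite /subst /= -!/(subst _ _) eqxx IH -?catA //; lia.
Qed.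

(** The first occurrence of [x] has no [x] before it. Hence no variable is linked to itself. *)
Lemma adj_same_lt x p : 0 < occ x p -> vadj x x p < occ x p.
Proof.
elim: p => //= c p IH; rewrite occ_cons; case: eqP => [_|_] /=; last first.
  by rewrite !add0n => /IH.
by have := adj_le_occ_behead x x (inl x :: p); rewrite /= eqxx /=; lia.
Qed.

Lemma linked_neq m (y y' : nat) p : 0 < m -> multiplicity m p ->
  m <= vadj y y' p -> y != y'.
Proof.
move=> m0 pm H; apply/eqP => yy'; rewrite -{}yy' in H.
have := adj_le_occ y y p; case: (posnP (occ y p)) => [|y0]; first by lia.
by have := adj_same_lt y0; rewrite (pm _ y0); lia.
Qed.

Lemma same_lang_erase m y y' p : 0 < m -> multiplicity m p ->
  m <= vadj y y' p -> same_lang (erase y' p) p.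
Proof.
move=> m0 pm H w; split; first exact: sublang_erase.
case=> h <-; exists (fun x => if x == y then h y ++ h y' else h x).
have le_occ x : occ x p <= m by case: (posnP (occ x p)) => [->//|/pm ->].
by apply: subst_linked (linked_neq m0 pm H) _ _; apply: leq_trans H.
Qed.

End Patterns.

(** * Markers and the long blocks of [b] in a word *)

Section Runs.
Variables (A : eqType) (a b : A) (L : nat).
Hypotheses (ab : a != b) (L_gt0 : 0 < L).
Implicit Types (u v w : word A) (st : option nat).

Definition flush st : seq nat :=
  if st is Some k then if L <= k then [:: k] else [::] else [::].

(* Lengths of the maximal blocks of [b] of length at least [L] that have a
   non-[b] letter on both sides; [st] is the length of the block being read,
   [None] standing for a block without left delimiter. *)
Fixpoint runs st u : seq nat :=
  if u is c :: u1 then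
    if c == b then runs (omap S st) u1 else flush st ++ runs (Some 0) u1
  else [::].

Lemma size_flush st : size (flush st) <= 1.
Proof. by case: st => //= k; case: ifP. Qed.

Lemma runs_state st v : exists2 t, size t <= 1 & runs st v = t ++ runs None v.
Proof.
elim: v st => [|c v IH] st /=; first by exists [::].
case: eqP => _; first exact: IH.
by exists (flush st); rewrite // size_flush.
Qed.

(** [t] holds the block of [b] that straddles the cut, if it is recorded; every other block is
    delimited within one of the two words. *)
Lemma runs_cat st u v :
  exists2 t, size t <= 1 & runs st (u ++ v) = runs st u ++ t ++ runs None v.
Proof.
elim: u st => [|c u IH] st /=; first exact: runs_state.
case: eqP => _; first exact: IH.
by have [t t1 ->] := IH (Some 0); exists t; rewrite // catA.
Qed.

Definition marker (N : nat) : word A := a :: nseq N b ++ [:: a].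

Lemma runs_nseq st N v : runs st (nseq N b ++ v) = runs (omap (addn N) st) v.
Proof.
elim: N st => [|N IH] st /=; first by case: st.
by rewrite eqxx IH; congr runs; case: st => //= k; rewrite addnS.
Qed.

Lemma runs_marker st N v : flush st = [::] -> L <= N ->
  runs st (marker N ++ v) = N :: runs (Some 0) v.
Proof.
move=> st0 LN; rewrite /= (negbTE ab) st0 /= -catA runs_nseq /= (negbTE ab).
by rewrite addn0 /= LN.
Qed.

Lemma runs_markers st ns v : flush st = [::] -> all (leq L) ns ->
  runs st (flatten (map marker ns) ++ v) =
  ns ++ runs (if ns is [::] then st else Some 0) v.
Proof.
elim: ns st => [|N ns IH] st st0 // /andP[LN Lns].
rewrite -[flatten _]/(marker N ++ flatten (map marker ns)) -catA.
rewrite runs_marker // IH //=.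
  by case: ns {IH Lns}.
(* Consecutive markers are separated by a block of length 0, below the threshold. *)
by rewrite leqNgt L_gt0.
Qed.

Section Blocks.
Variable K : nat.

(** The intervals are disjoint for distinct [y] and start at the threshold, so a length [t]
    determines its variable as [(t - L) %/ K]. *)
Definition block (y : nat) : seq nat := iota (L + y * K) K.
Definition markers (y : nat) : word A := flatten (map marker (block y)).

(** The hypothesis is an invariant: the block being read, prolonged by all letters still to come,
    stays shorter than [L]. So the letters of [p] never yield a recorded block. *)
Lemma runs_subst st (p : pattern A) :
  odflt 0 st + const_len p < L ->
  runs st (subst markers p) = flatten (map block (var_seq p)).
Proof.
have small st' n : odflt 0 st' + n < L -> flush st' = [::].
  by case: st' => //= k kn; rewrite leqNgt (leq_ltn_trans (leq_addr _ _) kn).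
elim: p st => [|[y|c] p IH] st // pL; rewrite /subst /= -/(subst _ _).
- rewrite runs_markers ?(small _ _ pL) //; last first.
    by apply/allP => n; rewrite mem_iota; lia.
  congr (_ ++ _); apply: IH.
  case: (block y) => //= _ _; apply: leq_ltn_trans pL.
  by rewrite /const_len /=; lia.
- case: eqP => _; last first.
    rewrite (small _ _ pL) /=; apply: IH; apply: leq_ltn_trans pL.
    by rewrite /const_len /=; lia.
  apply: IH; apply: leq_ltn_trans pL; rewrite /const_len /=.
  by case: st => //= k; lia.
Qed.

End Blocks.

Section Images.
Variables (g : nat -> word A).

(** Each symbol of [q] adds at most one straddling block to [cuts], and a single letter contains no
    run; all other runs lie inside the image of a variable. *)
Lemma runs_subst_mem (q : pattern A) :
  exists2 cuts : seq nat, size cuts <= size q &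
    forall j, j \in runs None (subst g q) ->
      j \in cuts \/ exists2 x, x \in vars q & j \in runs None (g x).
Proof.
elim: q => [|s q [cuts cuts_le cutsP]]; first by exists [::].
rewrite /subst /= -/(subst _ _).
have [t t1 ->] := runs_cat None (subst_sym g s) (subst g q).
exists (t ++ cuts) => [|j]; first by rewrite size_cat -add1n leq_add.
rewrite !mem_cat => /or3P[js|->|/cutsP[->|[x xq jx]]]; rewrite ?orbT; try by left.
  right; case: s js => [x|c] /=; last by case: eqP.
  by exists x; rewrite // mem_vars_inl mem_head.
by right; exists x => //; move: xq; rewrite !mem_vars_inl inE => ->; rewrite orbT.
Qed.

(** Each occurrence of [x] contributes the runs of [g x] as a contiguous factor, and concatenation
    destroys no adjacent pair. *)
Lemma adj_runs_subst x t t' (q : pattern A) :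
  occ x q * adj t t' (runs None (g x)) <= adj t t' (runs None (subst g q)).
Proof.
elim: q => //= s q IH; rewrite occ_cons /subst /= -/(subst _ _) mulnDl.
have [r _ ->] := runs_cat None (subst_sym g s) (subst g q).
apply: leq_trans (adj_cat_ge _ _ _ _); apply: leq_add; last first.
  apply: leq_trans (adj_cat_ge _ _ _ _); apply: leq_trans IH _.
  by rewrite leq_addl.
by case: eqP => [->|_]; rewrite ?mul1n ?mul0n.
Qed.

End Images.
End Runs.

(** * Adjacent markers and the bound on unlinked variables *)

Section BlockAdjacency.
Variables (L K : nat).
Local Notation block := (block L K.+1).

Lemma flatten_blocks_cons y ys :
  flatten (map block (y :: ys)) = block y ++ flatten (map block ys).
Proof. by []. Qed.

Lemma adj_block_cat (t t' y : nat) l :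
  adj t t' (block y ++ l) =
  adj t t' (block y) + ((L + y * K.+1 + K == t) && (ohead l == Some t'))
  + adj t t' l.
Proof.
rewrite /block adj_cat_cons; congr (_ + (_ && _) + _).
by rewrite (last_nth 0) size_iota -[_ :: _]/(iota (L + y * K.+1) K.+1) nth_iota.
Qed.

Lemma adj_blocks_inner (t t' : nat) ys : L <= t -> ((t - L) %% K.+1).+1 < K.+1 ->
  0 < adj t t' (flatten (map block ys)) -> t' = t.+1.
Proof.
move=> Lt tK; elim: ys => // y ys IH; rewrite flatten_blocks_cons adj_block_cat.
have := @adj_iota t t' (L + y * K.+1) K.+1; rewrite -/(block y).
case: posnP => [-> _|_ []//]; rewrite add0n addn_gt0 => /orP[|//].
case: eqP => //= tE; exfalso; move: tK; rewrite -tE.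
rewrite -addnA addKn modnMDl modn_small //; lia.
Qed.

(** The last length of a block is never followed by anything inside a block, so each such pair comes
    from a step from [y] to the next variable, which division recovers from [t']. *)
Lemma adj_blocks_last y t' ys :
  adj (L + y * K.+1 + K) t' (flatten (map block ys)) <= adj y ((t' - L) %/ K.+1) ys.
Proof.
elim: ys => // z ys IH; rewrite flatten_blocks_cons adj_block_cat leq_add //.
set n := adj _ _ _; have -> : n = 0.
  case: (posnP n) => // /adj_iota[_ H1 H2].
  have [zy|yz|E] := ltngtP z y; nia.
rewrite add0n eqn_add2r eqn_add2l eqn_pmul2r //.
case: eqP => //= _; case: ys {IH n} => //= z' ys.
rewrite !(inj_eq Some_inj); case: eqP => //= <-.
by rewrite addKn mulnK // eqxx.
Qed.

End BlockAdjacency.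

(* A substitution that writes many markers for each variable of [p] must put
   uncut markers of every variable [y] into the images of variables [x] of [q].
   As [x] occurs [m] times, what follows such a marker inside the image of [x]
   follows it everywhere, so that [y] is linked to its successor unless the
   last marker of the image of [x] belongs to [y]. *)
Lemma unlinked_bound (A : eqType) (a b : A) m (p q : pattern A) :
  a != b -> 0 < m -> (forall x, x \in vars q -> m <= occ x q) -> sublang p q ->
  exists2 Q : seq nat, size Q <= const_len p + size (vars q) &
    forall y, y \in vars p -> y \in Q \/ exists y', m <= vadj y y' p.
Proof.
(* [L] exceeds the number of letters of [p], so constants create no run; [K.+1] markers per variable
   exceed the number of possible cuts. *)
move=> ab m0 qm pq; set L := (const_len p).+1; set K := size q.
have [g gE] : inL q (subst (markers a b L K.+1) p) by apply: pq; eexists.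
have RE : runs b L None (subst g q) = flatten (map (block L K.+1) (var_seq p)).
  by rewrite gE runs_subst.
have [Q1 Q1s Q1P] := adj_filter (@is_letter A) p.
have [cuts cuts_le cutsP] := runs_subst_mem b L g q.
pose owner t := (t - L) %/ K.+1.
(* Two kinds of exceptions: variables that gain a link when the letters of [p] are deleted, and
   owners of the last run in the image of some [x]. *)
exists (var_seq Q1 ++ [seq owner (last 0 (runs b L None (g x))) | x <- vars q]).
  rewrite size_cat size_map leq_add2r; apply: leq_trans Q1s.
  by rewrite size_pmap count_size.
move=> y yp; case: (classic (exists y', m <= adj y y' (var_seq p))) => [[y' yy']|unl].
  have [yQ|yQ] := boolP (inl y \in Q1); first by left; rewrite mem_cat mem_var_seq yQ.
  right; exists y'; apply: leq_trans yy' (leq_trans _ (Q1P _ _ yQ)).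
  by rewrite -var_seqE adj_map // => u v [].
left; rewrite mem_cat; apply/orP; right.
(* The block has [K.+1] distinct lengths and there are at most [K] cuts, so some length is uncut. *)
have /allPn[t tB tC] : ~~ all (mem cuts) (block L K.+1 y).
  apply/negP => /allP sub; have := uniq_leq_size (iota_uniq _ _) sub.
  by rewrite size_iota ltnNge cuts_le.
have tR : t \in runs b L None (subst g q).
  rewrite RE; apply/flattenP; exists (block L K.+1 y) => //.
  by apply: map_f; rewrite -mem_undup.
case: (cutsP _ tR) => [tc|[x xq tx]]; first by rewrite /= tc in tC.
apply/mapP; exists x => //.
have [s1 [s2 gxE]] : exists s1 s2, runs b L None (g x) = s1 ++ t :: s2.
  by case/splitPr: tx => s1 s2; exists s1, s2.
have adjm t1 t2 : 0 < adj t1 t2 (t :: s2) -> m <= adj t1 t2 (runs b L None (subst g q)).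
  move=> H; apply: leq_trans (adj_runs_subst b L g x t1 t2 q).
  rewrite gxE; apply: leq_trans (qm x xq) _; rewrite leq_pmulr //.
  by apply: leq_trans H (leq_trans _ (adj_cat_ge _ _ _ _)); rewrite leq_addl.
have Lt : L <= t by move: tB; rewrite mem_iota; lia.
have ty : owner t = y.
  move: tB; rewrite mem_iota => /andP[t1 t2]; apply/eqP.
  by rewrite /owner eqn_leq -ltnS ltn_divLR // leq_divRL //; lia.
rewrite gxE last_cat /=; apply: esym; clear gxE s1 tx tR tC tB.
(* Walk from [t] to the last run of the image, keeping the owner [y]. Inside a block the next run is
   [t.+1]; at the end of a block [y] would be linked to the owner of [t'], against [unl]. *)
elim: s2 t Lt ty adjm => [|t' s2 IH] t Lt ty adjm //=.
have tt' : m <= adj t t' (runs b L None (subst g q)).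
  by apply: adjm; rewrite /= !eqxx.
rewrite RE in tt'.
have [tK|tK] := ltnP ((t - L) %% K.+1).+1 K.+1; last first.
  case: unl; exists (owner t'); apply: leq_trans tt' _.
  rewrite -[t](_ : L + y * K.+1 + K = t) ?adj_blocks_last //.
  have := divn_eq (t - L) K.+1; have := ltn_pmod (t - L) (ltn0Sn K).
  by rewrite -/(owner t) ty; lia.
have t'E := adj_blocks_inner Lt tK (leq_trans m0 tt').
apply: IH => [||t1 t2 H]; first by lia.
  have D := divn_eq (t - L) K.+1; rewrite -/(owner t) ty in D.
  by rewrite /owner t'E subSn // D -addnS divnMDl // divn_small // addn0.
by apply: adjm; rewrite /=; rewrite /= in H; lia.
Qed.

Lemma leq_sumn_mem (n : nat) (s : seq nat) : n \in s -> n <= sumn s.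
Proof.
by elim: s => //= k s IH; rewrite inE => /orP[/eqP ->|/IH]; [exact: leq_addr|lia].
Qed.

(** * Reduction to patterns with few variables *)

Section Reduction.
Variables (A : eqType) (a b : A) (m : nat).
Hypotheses (ab : a != b) (m_gt0 : 0 < m).
Implicit Types (p q : pattern A).

(** As long as some variable is linked to another, the latter is erased without changing the
    language. At the end all variables are unlinked, and [unlinked_bound] counts them. *)
Lemma sublang_reduced q p : multiplicity m q -> multiplicity m p -> sublang p q ->
  exists p', [/\ multiplicity m p', consts p' = consts p, same_lang p' p &
                 size (vars p') <= const_len p + size (vars q)].
Proof.
move=> qm; have [n] := ubnP (size p); elim: n p => // n IH p pn pm pq.
case: (classic (exists y y', m <= vadj y y' p)) => [[y [y' yy']]|unl].
  have y'p : y' \in vars p.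
    rewrite mem_vars; apply: leq_trans m_gt0 (leq_trans yy' _).
    exact: leq_trans (adj_le_occ_behead _ _ _) (occ_behead _ _).
  have pE := same_lang_erase m_gt0 pm yy'.
  have [|||p' [p'm p'c p'E p's]] := IH (erase y' p).
  - by have := size_erase pm y'p; lia.
  - exact: multiplicity_erase.
  - by move=> w /sublang_erase/pq.
  exists p'; split => //; first by rewrite p'c consts_erase.
    by move=> w; split=> [/p'E/pE|/pE/p'E].
  by move: p's; rewrite !const_lenE consts_erase.
have [|Q Qs QP] := unlinked_bound ab m_gt0 _ pq.
  by move=> x; rewrite mem_vars => /qm ->.
exists p; split => //; apply: leq_trans Qs.
apply: uniq_leq_size (vars_uniq p) _ => y /QP[//|[y' yy']].
by case: unl; exists y, y'.
Qed.

Lemma no_vars_lang q w : vars q = [::] -> inL q w -> w = consts q.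
Proof. by move=> q0 [h <-]; rewrite subst_no_vars. Qed.

Lemma witness_vars_bound q p :
    multiplicity m q -> multiplicity m p -> consts p = consts q -> ~ sublang p q ->
    (forall y, y \in vars p -> sublang (erase y p) q) ->
  size (vars p) <= 1 + (const_len q + m + 4) * size (vars q).
Proof.
move=> qm pm pqc npq pe; case Ep: (vars p) => [//|y l].
have yp : y \in vars p by rewrite Ep mem_head.
(* The count [1 + m + const_len q + size (vars q)] fits under the product once [q] has a variable.
   Otherwise [q] has a single word, and a second variable [x] of [p] would give a longer one. *)
rewrite -{l}Ep; case: (posnP (size (vars q))) => [/size0nil q0|q_gt0].
  rewrite q0 muln0 addn0; apply: (@uniq_leq_size _ _ [:: y]) (vars_uniq p) _ => x xp.
  rewrite inE; apply/negPn/negP => xy.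
  pose h z := if z == x then [:: a] else [::].
  have xe : x \in vars (erase y p) by rewrite mem_vars occ_erase (negbTE xy) -mem_vars.
  have /(no_vars_lang q0) E : inL q (subst h (erase y p)) by apply: (pe y yp); exists h.
  have := size_subst h (erase y p); rewrite E const_lenE consts_erase -pqc.
  have : 1 <= sumn [seq size (h z) | z <- var_seq (erase y p)].
    apply: leq_sumn_mem; apply/mapP; exists x; last by rewrite /h eqxx.
    by rewrite -mem_undup.
  by move=> /[swap] /eqP; rewrite -{1}[size _]addn0 eqn_add2l => /eqP <-.
have [|Q Qs QP] := unlinked_bound ab m_gt0 _ (pe y yp).
  by move=> x; rewrite mem_vars => /qm ->.
(* [Q2] collects the variables that may gain a link when [y] is erased; there are at most [m], one
   per occurrence of [y]. *)
have [Q2 Q2s Q2P] := adj_filter (pred1 (inl y : symbol A)) p.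
have Q2m : size (var_seq Q2) <= m.
  apply: leq_trans (_ : size Q2 <= m); first by rewrite size_pmap count_size.
  by apply: leq_trans Q2s _; rewrite -[count _ _]/(occ y p) pm // -mem_vars.
suff : size (vars p) <= size (y :: var_seq Q2 ++ Q).
  move: Qs; rewrite /= size_cat !const_lenE consts_erase pqc; nia.
apply: uniq_leq_size (vars_uniq p) _ => x xp; rewrite inE mem_cat.
have [//|xy] /= := eqVneq x y.
case: (QP x) => [|->|[x' xx']]; rewrite ?orbT //.
  by rewrite mem_vars occ_erase (negbTE xy) -mem_vars.
(* Otherwise [x] is linked to [x'] already in [p]; erasing [x'] keeps the language of [p], which
   would then be included in that of [q]. *)
rewrite mem_var_seq; case: (boolP (inl x \in Q2)) => //= xQ2; exfalso; apply: npq.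
have {}xx' : m <= vadj x x' p by apply: leq_trans xx' (Q2P _ _ xQ2).
have x'p : x' \in vars p.
  rewrite mem_vars; apply: leq_trans m_gt0 (leq_trans xx' _).
  exact: leq_trans (adj_le_occ_behead _ _ _) (occ_behead _ _).
by move=> w /(same_lang_erase m_gt0 pm xx')/(pe x' x'p).
Qed.

(** Variables are erased as long as the language stays outside that of [q]; a pattern where this
    stops satisfies [witness_vars_bound]. *)
Lemma small_witness q p :
    multiplicity m q -> multiplicity m p -> consts p = consts q -> ~ sublang p q ->
  exists p', [/\ multiplicity m p', consts p' = consts q, sublang p' p,
    ~ sublang p' q & size (vars p') <= 1 + (const_len q + m + 4) * size (vars q)].
Proof.
move=> qm; have [n] := ubnP (size p); elim: n p => // n IH p pn pm pqc npq.
case: (classic (exists2 y, y \in vars p & ~ sublang (erase y p) q)) => [[y yp ye]|all_e].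
  have [|||//|p' [? ? p'e ? ?]] := IH (erase y p).
  - by have := size_erase pm yp; lia.
  - exact: multiplicity_erase.
  - by rewrite consts_erase.
  by exists p'; split=> // w /p'e/sublang_erase.
exists p; split=> //; apply: witness_vars_bound => // y yp.
by apply: NNPP => ye; apply: all_e; exists y.
Qed.

End Reduction.

(** * Enumeration of the patterns with few variables *)

Section Enumeration.
Variable A : eqType.
Implicit Types (p q : pattern A) (w : word A).

Definition rename (f : nat -> nat) p : pattern A :=
  [seq if s is inl x then inl (f x) else s | s <- p].

Lemma subst_rename h f p : subst h (rename f p) = subst (h \o f) p.
Proof. by elim: p => //= -[x|c] p; rewrite /subst /= => ->. Qed.

Lemma var_seq_rename f p : var_seq (rename f p) = map f (var_seq p).
Proof. by elim: p => //= -[x|c] p /= ->. Qed.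

Lemma consts_rename f p : consts (rename f p) = consts p.
Proof. by elim: p => //= -[x|c] p /= ->. Qed.

Lemma same_lang_rename f g p : {in vars p, cancel f g} -> same_lang (rename f p) p.
Proof.
move=> fK w; split=> [[h <-]|[h <-]]; first by rewrite subst_rename; eexists.
exists (h \o g); rewrite subst_rename; apply: eq_in_subst => x xp /=.
by rewrite fK.
Qed.

(** Before [v] is inserted the pattern has length [size w + size vs1], which leaves
    [size w + size vs] positions, both ends included. *)
Fixpoint insertions w (vs : seq nat) : seq (pattern A) :=
  if vs is v :: vs1 then
    [seq take i p ++ inl v :: drop i p | p <- insertions w vs1,
                                         i <- iota 0 (size w + size vs)]
  else [:: map inr w].

Lemma size_insertions w vs :
  size (insertions w vs) <= (size w + size vs) ^ size vs.
Proof.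
elim: vs => //= v vs IH; rewrite size_allpairs size_iota expnSr leq_mul2r.
by apply/orP; right; apply: leq_trans IH _; case: (size vs) => // n; rewrite leq_exp2r // leq_add2l.
Qed.

Lemma mem_insertions p vs : perm_eq (var_seq p) vs -> p \in insertions (consts p) vs.
Proof.
elim: vs p => [|v vs IH] p pvs.
  rewrite inE; move/perm_nilP: pvs => pvs; apply/eqP.
  by elim: p pvs => //= -[x|c] p // IH /IH {1}->.
have vp : inl v \in p by rewrite -mem_var_seq (perm_mem pvs) mem_head.
have [p1 [p2 pE]] : exists p1 p2, p = p1 ++ inl v :: p2.
  by case/splitPr: vp => p1 p2; exists p1, p2.
apply/allpairsP; exists (p1 ++ p2, size p1); split => /=.
- have -> : consts p = consts (p1 ++ p2) by rewrite pE /consts !pmap_cat.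
  apply: IH; move: pvs; rewrite pE /var_seq !pmap_cat /= -/(var_seq _) -/(var_seq _).
  by rewrite -cat1s perm_catCA /= perm_cons.
- rewrite mem_iota /= add0n -[(size vs).+1](perm_size pvs) -const_lenE -size_pattern pE.
  by rewrite size_cat /=; lia.
- by rewrite take_size_cat // drop_size_cat.
Qed.

Definition candidates w m D : seq (pattern A) :=
  flatten [seq insertions w (flatten [seq nseq m i | i <- iota 0 k]) | k <- iota 0 D.+1].

Lemma size_flatten_nseq m (s : seq nat) : size (flatten [seq nseq m i | i <- s]) = size s * m.
Proof. by elim: s => //= i s IH; rewrite size_cat size_nseq IH mulSn. Qed.

Lemma size_flatten_le (T : eqType) (ss : seq (seq T)) B :
  {in ss, forall s, size s <= B} -> size (flatten ss) <= size ss * B.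
Proof.
elim: ss => //= s ss IH sB; rewrite size_cat mulSn leq_add ?sB ?mem_head //.
by apply: IH => s' s'ss; apply: sB; rewrite inE s'ss orbT.
Qed.

Lemma size_candidates w m D : 0 < D -> 0 < m ->
  size (candidates w m D) <= D.+1 * (size w + D * m) ^ (D * m).
Proof.
move=> D0 m0; set B := _ ^ _.
rewrite -[X in _ <= X * _](size_iota 0).
rewrite -(size_map (fun k => insertions w (flatten [seq nseq m i | i <- iota 0 k]))).
apply: size_flatten_le => _ /mapP[k + ->]; rewrite mem_iota add0n ltnS /= => kD.
apply: leq_trans (size_insertions _ _) _; rewrite size_flatten_nseq size_iota.
have kmD : k * m <= D * m by rewrite leq_mul2r kD orbT.
apply: (@leq_trans ((size w + D * m) ^ (k * m))).
  by case: (k * m) kmD => // n nD; rewrite leq_exp2r // leq_add2l.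
by rewrite /B leq_pexp2l //; rewrite addn_gt0 muln_gt0 D0 m0 orbT.
Qed.

(** Each variable is renamed to its index in [vars p], which is invertible on [vars p] and so keeps
    the language. *)
Lemma candidatesP w m D p : multiplicity m p -> consts p = w -> size (vars p) <= D ->
  exists2 p', p' \in candidates w m D & same_lang p' p.
Proof.
move=> pm <- pD; pose f x := index x (vars p).
exists (rename f p); last first.
  by apply: (@same_lang_rename _ (nth 0 (vars p))) => x xp; rewrite /f nth_index.
apply/flattenP; eexists.
  by apply/mapP; exists (size (vars p)); [rewrite mem_iota|].
rewrite -(consts_rename f); apply: mem_insertions; rewrite var_seq_rename.
apply: perm_trans (perm_map f (var_seq_perm pm)) _.
have -> : iota 0 (size (vars p)) = map f (vars p).
  apply: (@eq_from_nth _ 0); first by rewrite size_map size_iota.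
  move=> i; rewrite size_iota => ip; rewrite nth_iota // (nth_map 0) //.
  by rewrite /f index_uniq // vars_uniq.
rewrite map_flatten -!map_comp; apply/permP => P; congr (count P (flatten _)).
by apply: eq_map => x /=; rewrite map_nseq.
Qed.

End Enumeration.

(** * Construction of teaching sets *)

Section Teaching.
Variable A : eqType.
Implicit Types (p q : pattern A) (T : seq (word A * bool)).

Lemma consistent_cat p T1 T2 :
  consistent p (T1 ++ T2) <-> consistent p T1 /\ consistent p T2.
Proof.
split=> [H|[H1 H2] w c]; last by rewrite mem_cat => /orP[wT|wT]; [apply: H1|apply: H2].
by split=> w c wc; apply: H; rewrite mem_cat wc ?orbT.
Qed.

Lemma consistent_same_lang p q T : same_lang p q -> consistent p T -> consistent q T.
Proof.
move=> pq pT w c wT; have [pw1 pw2] := pT _ _ wT.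
by split=> [/pq/pw1|/pw2/pq].
Qed.

Lemma separating_example p q : exists T, [/\ size T <= 1, consistent p T,
    consistent q T -> same_lang q p &
    forall q', sublang q q' -> consistent q' T -> sublang q p].
Proof.
have [qp|nqp] := classic (sublang q p); last first.
  have [w wP] := not_all_ex_not _ _ nqp; have [qw npw] := imply_to_and _ _ wP.
  have no q' : sublang q q' -> ~ consistent q' [:: (w, false)].
    by move=> qq' /(_ w false (mem_head _ _))[/(_ (qq' w qw))].
  exists [:: (w, false)]; split=> // [v c|/(no q)[]|q' /no//] //.
  by rewrite inE => /eqP[-> ->].
have [pq|npq] := classic (sublang p q).
  by exists [::]; split=> // _ w; split=> [/qp|/pq].
have [w wP] := not_all_ex_not _ _ npq; have [pw nqw] := imply_to_and _ _ wP.
exists [:: (w, true)]; split=> // [v c|/(_ w true (mem_head _ _))[_ /(_ erefl)]//].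
by rewrite inE => /eqP[-> ->].
Qed.

Lemma separators p (ps : seq (pattern A)) :
  exists T, [/\ size T <= size ps, consistent p T,
    forall q, q \in ps -> consistent q T -> same_lang q p &
    forall q q', q \in ps -> sublang q q' -> consistent q' T -> sublang q p].
Proof.
elim: ps => [|r ps [T [Ts pT TP TP']]]; first by exists [::].
have [T1 [T1s pT1 T1P T1P']] := separating_example p r.
exists (T1 ++ T); split=> [||q|q q']; rewrite ?inE.
- by rewrite size_cat /= -add1n leq_add.
- exact/consistent_cat.
- by case/orP=> [/eqP-> /consistent_cat[/T1P]|/TP qP /consistent_cat[_ /qP]].
case/orP=> [/eqP-> rq' /consistent_cat[/(T1P' _ rq')]//|qps qq' /consistent_cat[_]].
exact: TP'.
Qed.

(** The examples are all subsequences of [consts p], only the full word being positive. Since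
    [consts p] is in the language of [q], [consts q] is one of them; being in that language, it is
    labelled positive. *)
Lemma consts_examples p : exists T, [/\ size T <= 2 ^ const_len p, consistent p T &
  forall q, consistent q T -> consts q = consts p].
Proof.
pose n := size (consts p); pose ms := [seq mask (val bs) (consts p) | bs : n.-tuple bool].
exists [seq (v, v == consts p) | v <- ms]; split.
- by rewrite size_map size_image card_tuple card_bool const_lenE.
- move=> w c /mapP[v /mapP[bs _ vE] [-> ->]]; split=> [|/eqP ->]; last exact: inL_consts.
  move/inL_subseq => sv; rewrite eq_sym; have [le eq] := size_subseq_leqif sv.
  by rewrite -eq eqn_leq le size_subseq // vE mask_subseq.
move=> q qT; have in_ms v : subseq v (consts p) -> v \in ms.
  case/subseqP=> bs bsn vE; apply/mapP.
  by exists (tcast bsn (in_tuple bs)); rewrite ?mem_enum //= val_tcast.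
have qp : subseq (consts q) (consts p).
  apply: inL_subseq; apply/(qT _ true) => //; apply/mapP.
  by exists (consts p); rewrite ?eqxx //; apply: in_ms.
apply/eqP; apply: (proj1 (qT _ (consts q == consts p) _) (inL_consts q)).
by apply/mapP; exists (consts q) => //; apply: in_ms.
Qed.

Lemma TDle_is_TD (Pi : pattern A -> Prop) p n :
  TDle Pi p n -> exists2 k, is_TD Pi p (Some k) & k <= n.
Proof.
elim/ltn_ind: n => n IH pn.
case: (classic (exists2 k, k < n & TDle Pi p k)) => [[k kn /(IH k kn)[j pj jk]]|min].
  by exists j => //; apply: leq_trans jk (ltnW kn).
exists n => //; split=> // k pk; rewrite leqNgt; apply/negP => kn.
by apply: min; exists k.
Qed.

End Teaching.

Lemma QR_TDle (A : eqType) (a b : A) m (p : pattern A) :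
  a != b -> 0 < m -> QR m p ->
  let D := 1 + (const_len p + m + 4) * size (vars p) in
  TDle (QR m) p (2 ^ const_len p + D.+1 * (const_len p + D * m) ^ (D * m)).
Proof.
move=> ab m0 [_ pm] D.
have [T1 [T1s pT1 T1P]] := consts_examples p.
have [T2 [T2s pT2 T2P T2P']] := separators p (candidates (consts p) m D).
exists (T1 ++ T2); split; last first.
  rewrite size_cat leq_add //; apply: leq_trans T2s _.
  by rewrite const_lenE; apply: size_candidates.
split=> [|q [_ qm] /consistent_cat[/T1P qc qT2]]; first exact/consistent_cat.
(* A small witness inside [q] has an equivalent candidate [q2]; its negative example would exclude
   the larger language of [q]. *)
have qp : sublang q p.
  apply: NNPP => nqp.
  have [q1 [q1m q1c q1q nq1p q1s]] := small_witness ab m0 pm qm qc nqp.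
  have [q2 q2c q2q1] := candidatesP q1m q1c q1s.
  apply: nq1p => w /q2q1; apply: (T2P' q2 q q2c) => // v /q2q1; exact: q1q.
(* With a variable in [p], [D] is at least [const_len p + size (vars p)], so [q] reduces to a
   candidate. *)
case: (posnP (size (vars p))) => [/size0nil p0|p_gt0].
  move=> w; split=> [/qp//|/(no_vars_lang p0) ->]; rewrite -qc; exact: inL_consts.
have [q1 [q1m q1c q1q q1s]] := sublang_reduced ab m0 pm qm qp.
have q1D : size (vars q1) <= D.
  by apply: leq_trans q1s _; rewrite !const_lenE qc /D const_lenE; nia.
have [q2 q2c q2q1] := candidatesP q1m (etrans q1c qc) q1D.
have q2p : same_lang q2 p.
  apply: (T2P q2 q2c); apply: consistent_same_lang qT2 => w.
  by split=> [/q1q/q2q1|/q2q1/q1q].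
by move=> w; rewrite -q2p; split=> [/q1q/q2q1|/q2q1/q1q].
Qed.

(** * The one-letter alphabet *)

Section Unary.
Variables (A : eqType) (a0 : A) (m : nat).
Hypotheses (unary : forall x : A, x = a0) (m_gt0 : 0 < m).
Implicit Types (p q : pattern A) (w v : word A).

Lemma unary_word w : w = nseq (size w) a0.
Proof. by elim: w => //= c w <-; rewrite (unary c). Qed.

Lemma unary_word_eq w v : size w = size v -> w = v.
Proof. by move=> wv; rewrite [w]unary_word [v]unary_word wv. Qed.

(** Words are determined by their lengths, and one variable can take up the whole multiple of
    [m]. *)
Lemma inL_unary p w : multiplicity m p ->
  inL p w <-> exists2 j, size w = const_len p + m * j & vars p = [::] -> j = 0.
Proof.
move=> pm; split=> [[h <-]|[j wj j0]].
  by eexists; [exact: size_subst_mult|move=> ->].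
case Ep: (vars p) => [|x l].
  rewrite [w](_ : _ = consts p); first exact: inL_consts.
  by apply: unary_word_eq; rewrite wj j0 // muln0 addn0 const_lenE.
exists (fun z => if z == x then nseq j a0 else [::]); apply: unary_word_eq.
rewrite (size_subst_mult _ pm) wj Ep /= eqxx size_nseq.
have := vars_uniq p; rewrite Ep /= => /andP[xl _].
suff -> : sumn [seq size (if z == x then nseq j a0 else [::]) | z <- l] = 0.
  by rewrite addn0.
elim: l xl {Ep} => //= z l IH; rewrite inE negb_or eq_sym => /andP[/negbTE -> /IH ->] //.
Qed.

Definition unary_pattern (c k : nat) : pattern A := nseq c (inr a0) ++ nseq k (inl 0).

Lemma occ_unary_pattern x c k : occ x (unary_pattern c k) = (x == 0) * k.
Proof.
by rewrite /occ count_cat !count_nseq mul0n add0n inl_eq eq_sym.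
Qed.

Lemma const_len_unary_pattern c k : const_len (unary_pattern c k) = c.
Proof. by rewrite /const_len count_cat !count_nseq mul1n mul0n addn0. Qed.

Lemma vars_unary_pattern c k : (vars (unary_pattern c k) == [::]) = (k == 0).
Proof.
apply/eqP/eqP => [E|->].
  have := mem_vars 0 (unary_pattern c k); rewrite E occ_unary_pattern mul1n.
  by case: k {E}.
case E: (vars _) => [//|x l]; have := mem_vars x (unary_pattern c 0).
by rewrite E mem_head occ_unary_pattern muln0.
Qed.

Lemma QR_unary_pattern c (v : bool) : (0 < c) || v -> QR m (unary_pattern c (v * m)).
Proof.
move=> cv; split=> [E|x].
  have := congr1 size E; rewrite size_cat !size_nseq; case: v cv {E} => /=; lia.
by rewrite occ_unary_pattern; case: eqP => //=; case: v cv; rewrite ?mul1n.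
Qed.

Lemma inL_unary_finite c w : inL (unary_pattern c 0) w <-> size w = c.
Proof.
have pm : multiplicity m (unary_pattern c 0).
  by move=> x; rewrite occ_unary_pattern muln0.
split=> [/(inL_unary _ pm)[j]|wc]; rewrite ?const_len_unary_pattern.
  have E : vars (unary_pattern c 0) = [::] by apply/eqP; rewrite vars_unary_pattern.
  by move=> -> /(_ E) ->; rewrite muln0 addn0.
by apply/(inL_unary _ pm); exists 0; rewrite ?const_len_unary_pattern // muln0 addn0.
Qed.

Lemma inL_unary_infinite c w :
  inL (unary_pattern c m) w <-> exists j, size w = c + m * j.
Proof.
have pm : multiplicity m (unary_pattern c m).
  by move=> x; rewrite occ_unary_pattern; case: eqP => //; rewrite mul1n.
split=> [/(inL_unary _ pm)[j]|[j wj]]; rewrite ?const_len_unary_pattern.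
  by exists j.
apply/(inL_unary _ pm); exists j; rewrite ?const_len_unary_pattern //.
by move/eqP; rewrite vars_unary_pattern => /eqP E; move: m_gt0; rewrite E.
Qed.

(** With [c] positive, the label of length [c + m] tells whether variables occur, and a negative
    example of length [c - m], where it exists, fixes the number of letters. *)
Lemma unary_TDle p : QR m p -> TDle (QR m) p 3.
Proof.
move=> [_ pm]; set c := const_len p; pose wd n := nseq n a0.
have L r n : multiplicity m r -> inL r (wd n) <->
    exists2 j, n = const_len r + m * j & vars r = [::] -> j = 0.
  by move=> rm; split=> [/(inL_unary _ rm)|H]; [|apply/(inL_unary _ rm)]; rewrite size_nseq.
have same q : multiplicity m q -> const_len q = c -> (vars q = [::] <-> vars p = [::]) ->
    same_lang q p.
  move=> qm qc qp w; split=> [/(inL_unary _ qm)[j wj j0]|/(inL_unary _ pm)[j wj j0]].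
    by apply/(inL_unary _ pm); exists j => [|/qp/j0 //]; rewrite wj qc.
  by apply/(inL_unary _ qm); exists j => [|/qp/j0 //]; rewrite wj qc.
have pc : inL p (wd c) by apply/(L _ _ pm); exists 0; rewrite // muln0 addn0.
have [p0|p1] := eqVneq (vars p) [::].
  exists [:: (wd c, true); (wd (c + m), false)]; split=> //; split.
    move=> w e; rewrite !inE => /orP[/eqP[-> ->]//|/eqP[-> ->]].
    split=> // /(L _ _ pm)[j + /(_ p0) j0]; rewrite j0 -/c; lia.
  move=> q [_ qm] qT.
  have /(L _ _ qm)[j cj j0] : inL q (wd c) by apply/(qT _ true) => //; rewrite mem_head.
  have qn : ~ inL q (wd (c + m)) by move/(qT _ false); rewrite !inE eqxx orbT => /(_ isT).
  have q0 : vars q = [::].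
    apply: NNPP => q1; apply: qn; apply/(L _ _ qm); exists j.+1 => //.
    by rewrite cj; lia.
  by apply: same => //; rewrite cj j0 // muln0 addn0.
have pcm : inL p (wd (c + m)).
  by apply/(L _ _ pm); exists 1; rewrite ?muln1 // => /eqP; rewrite (negbTE p1).
have nc : m <= c -> ~ inL p (wd (c - m)) by move=> mc /(L _ _ pm)[j]; rewrite -/c; lia.
exists ([:: (wd c, true); (wd (c + m), true)] ++
        if m <= c then [:: (wd (c - m), false)] else [::]); split; last by case: ifP.
split.
  apply/consistent_cat; split=> w e; first by rewrite !inE => /orP[]/eqP[-> ->].
  by case: ifP => // mc; rewrite inE => /eqP[-> ->]; split=> // /(nc mc).
move=> q [_ qm] /consistent_cat[qT qT'].
have /(L _ _ qm)[j cj j0] : inL q (wd c) by apply/(qT _ true) => //; rewrite mem_head.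
have /(L _ _ qm)[i ci i0] : inL q (wd (c + m)).
  by apply/(qT _ true) => //; rewrite !inE eqxx orbT.
have q1 : vars q <> [::] by move=> q0; rewrite i0 // j0 // in ci cj; lia.
apply: same => //; last by split=> // E; rewrite E in p1.
case: j cj {j0} => [->|j cj]; first by rewrite muln0 addn0.
have mc : m <= c by rewrite cj; lia.
have : inL q (wd (c - m)) by apply/(L _ _ qm); exists j => //; rewrite cj; lia.
by rewrite mc in qT'; move/(qT' _ false); rewrite mem_head => /(_ isT).
Qed.

(** Without a negative example the progression starting at 0 fits as well; with at most one positive
    word a variable-free pattern fits. So one negative and two positive examples are needed. *)
Lemma unary_TD_ge3 n : TDle (QR m) (unary_pattern m m) n -> 3 <= n.
Proof.
case=> T [[pT TP] Tn]; rewrite leqNgt; apply/negP => n3.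
set p := unary_pattern m m in pT TP.
have pP w : inL p w <-> exists j, size w = m + m * j by exact: inL_unary_infinite.
have [v vT] : exists v, (v, false) \in T.
  apply: NNPP => none.
  have Q0 : QR m (unary_pattern 0 m).
    by have := @QR_unary_pattern 0 true isT; rewrite mul1n.
  have H : same_lang (unary_pattern 0 m) p.
    apply: TP Q0 _ => w [] wT; last by case: none; exists w.
    split=> // _; have /pP[j wj] : inL p w by apply/(pT _ true).
    by apply/inL_unary_infinite; exists j.+1; rewrite wj; lia.
  have /H /pP[j] : inL (unary_pattern 0 m) [::].
    by apply/inL_unary_infinite; exists 0; rewrite muln0.
  by rewrite /=; lia.
have [k kP] : exists k, forall w, (w, true) \in T -> size w = m + m * k.
  case: (classic (exists u, (u, true) \in T)) => [[u uT]|none]; last first.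
    by exists 0 => w wT; case: none; exists w.
  have /pP[k uk] : inL p u by apply/(pT _ true).
  exists k => w wT; rewrite -uk; congr size; apply: NNPP => wu.
  have : size [:: (v, false); (u, true); (w, true)] <= size T.
    apply: uniq_leq_size => [|x].
      by rewrite /= !inE !xpair_eqE /= !andbF !andbT /=; apply/eqP => uw; apply: wu.
    by rewrite !inE => /or3P[]/eqP->.
  by rewrite /=; lia.
have H : same_lang (unary_pattern (m + m * k) 0) p.
  apply: TP; first by apply: (@QR_unary_pattern _ false); rewrite addn_gt0 m_gt0.
  move=> w [] wT; first by split=> // _; apply/inL_unary_finite/kP.
  split=> // /inL_unary_finite wk; apply/(pT _ false wT).
  by apply/pP; exists k.
have : inL p (nseq (m + m * k.+1) a0) by apply/pP; exists k.+1; rewrite size_nseq.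
by move/H/inL_unary_finite; rewrite size_nseq; lia.
Qed.

End Unary.

Theorem mainTheorem8 :
  forall m : nat, 1 <= m ->
  (* case z = 1: any one-letter alphabet *)
  (forall (A : countType) (a0 : A), (forall x : A, x = a0) ->
     is_TD_class (QR (A := A) m) (Some 3)) /\
  (* case z >= 2: the O(.) constant may depend on m and the alphabet *)
  (forall (A : countType) (a b : A), a != b ->
     exists C : rat, forall p : pattern A, QR m p ->
       exists n : nat, is_TD (QR m) p (Some n) /\
         (n%:R <= C * TD_bound m p)%R).
Proof.
move=> m m_gt0; split=> [A a0 unary|A a b ab].
  split=> [p /(unary_TDle unary m_gt0)/TDle_is_TD[k pk k3]|n nP]; first by exists k.
  have [|k [[pk _] kn]] := nP (unary_pattern a0 m m).
    by rewrite -{3}[m]mul1n; apply: (@QR_unary_pattern _ a0 m m_gt0 m true); rewrite orbT.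
  exact: leq_trans (unary_TD_ge3 unary m_gt0 pk) kn.
(* The factor 2 absorbs [D.+1 <= 2 * D]; the rest is monotonicity in [D * m <= Dm m p]. *)
exists 2%:R%R => p pQR; have := QR_TDle ab m_gt0 pQR.
set D := (1 + _ * _)%N => /TDle_is_TD[n pn nB]; exists n; split=> //.
apply: (@le_trans _ _ (2 ^ const_len p + D.+1 * (const_len p + D * m) ^ (D * m))%N%:R%R).
  by rewrite ler_nat.
rewrite /TD_bound; set e := const_len p in nB *; set dm := Dm m p.
have Ddm : D * m <= dm by rewrite /dm /Dm leq_max mulnC leqnn orbT.
have D_le : (D%:R <= dm%:R / m%:R :> rat)%R by rewrite ler_pdivlMr ?ltr0n // -natrM ler_nat.
have pow_le : (e + D * m) ^ (D * m) <= (e + dm) ^ dm.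
  have Dm0 : 0 < D * m by rewrite muln_gt0 m_gt0.
  apply: (@leq_trans ((e + dm) ^ (D * m))); first by rewrite leq_exp2r // leq_add2l.
  by rewrite leq_pexp2l // addn_gt0 (leq_trans Dm0 Ddm) orbT.
rewrite natrD mulrDr; apply: lerD.
  by rewrite ler_peMl // ler1n.
rewrite natrM mulrA; apply: ler_pM => //; last by rewrite -natrX ler_nat.
apply: le_trans (_ : _ <= 2%:R * D%:R)%R _; last by rewrite ler_pM2l.
by rewrite -natrM ler_nat /D; lia.
Qed.
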